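(* Let $n\ge 1$ and $A=\frac12(ee^T-I)\in\mathbb{S}^n$. Let $\mu,\sigma\in\mathbb{R}^n$ with $\mu_i\in[0,1]$ and $0\le\sigma_i\le\sqrt{\mu_i(1-\mu_i)}$ for all $i$, and suppose the marginal moments satisfy $$\max_{i=1,\dots,n}\frac{\sigma_i^2}{(1-\mu_i)^2+\sigma_i^2}\le\min_{i=1,\dots,n}\frac{\mu_i^2}{\mu_i^2+\sigma_i^2}.$$ Let $$v^* = \max\left\{\mathbb{E}_{\mathbb{P}}[\tilde\xi^TA\tilde\xi] : \mathbb{P}\in\mathcal{P}([0,1]^n),\ \mathbb{E}_{\mathbb{P}}[\tilde\xi]=\mu,\ \mathbb{E}_{\mathbb{P}}[\mathrm{diag}(\tilde\xi\tilde\xi^T)]=\mathrm{diag}(\mu\mu^T+\sigma\sigma^T)\right\}.$$ Then the best possible upper bound is given by $$v^*=\sum_{i<j}\left(\mu_i\mu_j+\sigma_i\sigma_j\right).$$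
   Context: $\mathbb{S}^n$ is the space of symmetric real $n\times n$ matrices, $e$ the all-ones vector, $I$ the identity matrix; $\mathcal{P}([0,1]^n)$ is the set of probability distributions with support contained in $[0,1]^n$, and $\tilde\xi$ is the random vector with distribution $\mathbb{P}$; $\mathrm{diag}(A)$ is the vector of diagonal entries of $A$. The sum runs over pairs $1\le i<j\le n$. The vectors $\mu,\sigma$ are the vectors of means and standard deviations of $\tilde\xi$. The displayed fractions are assumed to be well defined (nonzero denominators). *)

(* Defs.v *)
From HB Require Import structures.
From mathcomp Require Import all_boot all_order all_algebra.
From mathcomp Require Import all_classical all_reals all_analysis.

Set Implicit Arguments.
Unset Strict Implicit.
Unset Printing Implicit Defensive.

Import Order.TTheory GRing.Theory Num.Theory.
Import numFieldNormedType.Exports.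

Local Open Scope classical_set_scope.
Local Open Scope ring_scope.

(* The library puts no measurable structure on ['cV[R]_n], so a distribution
   on R^n lives on [n.-tuple R], whose sigma-algebra is generated by the
   coordinate projections into the Borel line, i.e. the Borel sigma-algebra of
   R^n. *)
Definition vecspace (R : realType) (n : nat) := n.-tuple (measurableTypeR R).

Definition xi (R : realType) (n : nat) (w : vecspace R n) : 'cV[R]_n :=
  \col_i (tnth w i : R).

Definition ones (R : realType) (n : nat) : 'cV[R]_n := const_mx 1.

Definition Amat (R : realType) (n : nat) : 'M[R]_n :=
  2^-1 *: (ones R n *m (ones R n)^T - 1%:M).

Definition quadform (R : realType) (n : nat) (A : 'M[R]_n) (x : 'cV[R]_n) : R :=
  (x^T *m A *m x) ord0 ord0.

Definition diag (R : realType) (n : nat) (A : 'M[R]_n) : 'cV[R]_n :=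
  \col_i A i i.

Definition cube (R : realType) (n : nat) : set (vecspace R n) :=
  [set w | forall i, 0 <= xi w i ord0 <= 1].

(* Topological support: the points all of whose neighbourhoods have positive
   measure; open balls of the sup norm form a neighbourhood basis. *)
Definition supp (R : realType) (n : nat)
    (P : probability (vecspace R n) R) : set (vecspace R n) :=
  [set w | forall r : R, 0 < r ->
     (0 < P [set y | forall i, `|xi y i ord0 - xi w i ord0| < r]%R)%E].

(* The expectation of a random vector is taken coordinatewise. *)
Definition has_mean (R : realType) (n : nat) (P : probability (vecspace R n) R)
    (X : vecspace R n -> 'cV[R]_n) (m : 'cV[R]_n) : Prop :=
  forall i, ('E_P[fun w => X w i ord0] = (m i ord0)%:E)%E.

Definition feasible (R : realType) (n : nat) (mu sigma : 'cV[R]_n) :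
    set (probability (vecspace R n) R) :=
  [set P : probability (vecspace R n) R | [/\ supp P `<=` @cube R n,
               has_mean P (@xi R n) mu &
               has_mean P (fun w => diag (xi w *m (xi w)^T))
                          (diag (mu *m mu^T + sigma *m sigma^T))]].

Definition values (R : realType) (n : nat) (A : 'M[R]_n)
    (mu sigma : 'cV[R]_n) : set (\bar R) :=
  [set 'E_P[fun w => quadform A (xi w)]%E | P in feasible mu sigma].

Definition is_max (R : realType) (V : set (\bar R)) (v : \bar R) : Prop :=
  V v /\ ubound V v.

(* For nonempty index sets only, so that the iteration of the binary operation
   can start from an actual member of the family. *)
Definition max_over (R : realType) (n : nat) (hn : (0 < n)%N)
    (F : 'I_n -> R) : R :=
  \big[Num.max/F (Ordinal hn)]_(i < n) F i.

Definition min_over (R : realType) (n : nat) (hn : (0 < n)%N)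
    (F : 'I_n -> R) : R :=
  \big[Num.min/F (Ordinal hn)]_(i < n) F i.

(* Main.v *)
Require Import Defs.
From HB Require Import structures.
From mathcomp Require Import all_boot all_order all_algebra.
From mathcomp Require Import all_classical all_reals all_analysis.
From mathcomp Require Import measurable_realfun ring lra zify.
Import Order.TTheory GRing.Theory Num.Theory.
Import numFieldNormedType.Exports.
Local Open Scope ring_scope.

(* The upper bound is Cauchy-Schwarz applied to each covariance; the second
   moments being finite, the support plays no role.  For attainment, all
   covariances must equal [sigma_i * sigma_j] at once, which forces comonotone
   coordinates: the two-point law taking the value
   [mu + sqrt ((1 - p) / p) sigma] with probability [p] and
   [mu - sqrt (p / (1 - p)) sigma] with probability [1 - p].  Its atoms lie in
   the cube exactly when [p] is between the two sides of the moment condition,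
   and such a [p] can be taken in the open interval ]0, 1[. *)

(** * Laws with two atoms *)

Section TwoPointLaw.
Context {d} {T : measurableType d} {R : realType}.

Definition two_point (a b : T) (c : bool) : T := if c then a else b.

Lemma measurable_two_point (a b : T) : measurable_fun setT (two_point a b).
Proof. by []. Qed.

HB.instance Definition _ (a b : T) :=
  isMeasurableFun.Build _ _ _ _ (two_point a b) (measurable_two_point a b).

(** As an image of a Bernoulli law this is a probability measure for every real [p]; the weights [p]
    on [a] and [1 - p] on [b] are only claimed for [p] in [0, 1]. *)
Definition two_point_law (p : R) (a b : T) : probability T R :=
  distribution (bernoulli_prob p) (two_point a b).

Lemma two_point_law_eq0 (p : R) (a b : T) (S : set T) :
  ~ S a -> ~ S b -> two_point_law p a b S = 0%E.
Proof.
move=> Sa Sb; rewrite /two_point_law /distribution/= /pushforward.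
suff -> : (two_point a b @^-1` S)%classic = set0 by rewrite measure0.
by apply/seteqP; split => // -[].
Qed.

(** Change of variables is applied to nonnegative integrands, hence to the positive and negative
    parts of [f] separately; they recombine by x = max(x, 0) - max(-x, 0). *)
Lemma expectation_two_point_law (p : R) (a b : T) (f : T -> R) :
  0 <= p <= 1 -> measurable_fun setT f ->
  'E_(two_point_law p a b)[f]%E = (p * f a + (1 - p) * f b)%:E.
Proof.
move=> p01 /measurable_EFinP mf.
rewrite unlock integralE.
rewrite !ge0_integral_distribution//;
  [|exact: measurable_funeneg|exact: measurable_funepos].
rewrite !integral_bernoulli_prob//;
  [|by move=> x; exact: funeneg_ge0|by move=> x; exact: funepos_ge0].
rewrite /two_point/= !funeposE !funenegE -!EFinN -!EFin_max.
rewrite -!EFinM -!EFinD /unstable.onem; congr EFin.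
have maxB (x : R) : Num.max x 0 = x + Num.max (- x) 0.
  by case: (leP x 0) => ?; case: (leP (- x) 0) => ?; lra.
rewrite (maxB (f a)) (maxB (f b)); ring.
Qed.

End TwoPointLaw.

(** * Square integrability and the covariance bound *)

Section SecondMoment.
Context {d} {T : measurableType d} {R : realType} (P : probability T R).

Lemma Lfun2_of_integrable_sqr (X : T -> R) : measurable_fun setT X ->
  P.-integrable setT (EFin \o (fun x => X x ^+ 2)) -> X \in Lfun P 2%:E.
Proof.
move=> mX /integrableP[_ X2]; rewrite inE; apply/andP; split; rewrite inE//=.
rewrite /finite_norm unlock poweR_lty//; apply: le_lt_trans X2.
by under eq_integral do rewrite /= powR_mulrn// -normrX.
Qed.

(** The square is its own absolute value, so a real value of its expectation already bounds the
    integral that defines integrability. *)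
Lemma Lfun2_of_expectation (X : T -> R) (m2 : R) : measurable_fun setT X ->
  'E_P[fun x => (X x ^+ 2)%R]%E = m2%:E -> X \in Lfun P 2%:E.
Proof.
rewrite unlock => mX EX2; apply: Lfun2_of_integrable_sqr => //.
apply/integrableP; split; first exact/measurable_EFinP/measurable_funX.
under eq_integral do rewrite /= ger0_norm ?sqr_ge0//.
by rewrite EX2 ltry.
Qed.

Lemma expectation_mul_le (X Y : T -> R) (mx my sx sy : R) :
  0 <= sx -> 0 <= sy ->
  X \in Lfun P 2%:E -> Y \in Lfun P 2%:E ->
  'E_P[X]%E = mx%:E -> 'E_P[fun x => (X x ^+ 2)%R]%E = (mx ^+ 2 + sx ^+ 2)%:E ->
  'E_P[Y]%E = my%:E -> 'E_P[fun x => (Y x ^+ 2)%R]%E = (my ^+ 2 + sy ^+ 2)%:E ->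
  ('E_P[fun x => (X x * Y x)%R] <= (mx * my + sx * sy)%:E)%E.
Proof.
move=> sx0 sy0 X2 Y2 EX EX2 EY EY2.
have Pfin : P setT \is a fin_num := fin_num_measure P _ measurableT.
have X1 := Lfun_subset12 Pfin X2.
have Y1 := Lfun_subset12 Pfin Y2.
have XY1 := Lfun2_mul_Lfun1 X2 Y2.
have VX : 'V_P[X]%E = (sx ^+ 2)%:E.
  by rewrite varianceE// EX EX2 -EFin_expe -EFinB; congr EFin; ring.
have VY : 'V_P[Y]%E = (sy ^+ 2)%:E.
  by rewrite varianceE// EY EY2 -EFin_expe -EFinB; congr EFin; ring.
(* Cauchy-Schwarz bounds the covariance by the product of the square roots of the variances, which
   is [sx * sy] because both are nonnegative. *)
have := covariance_le X2 Y2.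
rewrite covarianceE// VX VY EX EY -EFinM leeBlDr// /= !sqrtr_sqr !ger0_norm//.
by rewrite -EFinM -EFinD addrC.
Qed.

End SecondMoment.

(** * The quadratic form as a sum over pairs, and the upper bound *)

Lemma quadform_Amat (R : realType) (n : nat) (x : 'cV[R]_n) :
  quadform (Amat R n) x =
  \sum_(i < n) \sum_(j < n | (i < j)%N) x i ord0 * x j ord0.
Proof.
pose S := \sum_(i < n) \sum_(j < n | (i < j)%N) x i ord0 * x j ord0.
have SC : \sum_(i < n) \sum_(j < n | (j < i)%N) x i ord0 * x j ord0 = S.
  rewrite (exchange_big_dep xpredT)//=; apply: eq_bigr => i _.
  by apply: eq_bigr => j _; rewrite mulrC.
(* The matrix is 1/2 off the diagonal and 0 on it; each unordered pair occurs twice, which cancels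
   the factor 1/2. *)
have AE i j : Amat R n i j = 2^-1 * (i != j)%:R.
  rewrite !mxE big_ord1 !mxE mulr1.
  by case: eqP => _ /=; rewrite ?subrr ?subr0.
have QE : quadform (Amat R n) x =
    2^-1 * \sum_(i < n) \sum_(j < n | j != i) x i ord0 * x j ord0.
  rewrite /quadform mxE mulr_sumr; apply: eq_bigr => j _.
  rewrite mxE mulr_suml mulr_sumr [RHS]big_mkcond; apply: eq_bigr => i _.
  by rewrite AE mxE; case: eqP => _ /=; ring.
rewrite QE (eq_bigr (fun i : 'I_n =>
    \sum_(j < n | (i < j)%N) x i ord0 * x j ord0 +
    \sum_(j < n | (j < i)%N) x i ord0 * x j ord0)).
  by rewrite big_split/= SC -/S -mulr2n -(mulr_natl S) mulKf ?pnatr_eq0.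
move=> i _; rewrite (bigID (fun j : 'I_n => (i < j)%N))/=; congr (_ + _);
  apply: eq_bigl => j; rewrite -(inj_eq val_inj)/=; lia.
Qed.

Lemma expectation_bigsum {d} {T : measurableType d} {R : realType}
    (P : probability T R) (I : Type) (s : seq I) (Q : pred I) (f : I -> T -> R) :
  (forall i, Q i -> f i \in Lfun P 1%E) ->
  'E_P[\sum_(i <- s | Q i) f i]%E = (\sum_(i <- s | Q i) 'E_P[f i])%E.
Proof.
move=> f1; elim: s => [|i s IHs]; first by rewrite !big_nil expectation_cst.
rewrite !big_cons; case: ifP => // Qi.
by rewrite expectationD ?IHs// ?f1// rpred_sum.
Qed.

Section RandomVector.
Context {R : realType} {n : nat}.
Implicit Types (mu sigma x : 'cV[R]_n) (i j : 'I_n).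

Lemma measurable_xi i :
  measurable_fun setT (fun w : vecspace R n => xi w i ord0).
Proof.
under eq_fun do rewrite mxE.
exact: measurable_tnth.
Qed.

Lemma measurable_quadform_xi (A : 'M[R]_n) :
  measurable_fun setT (fun w : vecspace R n => quadform A (xi w)).
Proof.
rewrite /quadform; under eq_fun do rewrite mxE.
apply: measurable_sum => j; apply: measurable_funM; last exact: measurable_xi.
under eq_fun do rewrite mxE.
apply: measurable_sum => i; apply: measurable_funM; last exact: measurable_cst.
by under eq_fun do rewrite mxE; exact: measurable_xi.
Qed.

Lemma diag_outer x i : diag (x *m x^T) i ord0 = x i ord0 ^+ 2.
Proof. by rewrite !mxE big_ord1 mxE expr2. Qed.

Lemma has_mean_diag (P : probability (vecspace R n) R) mu sigma i :
  has_mean P (fun w => diag (xi w *m (xi w)^T))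
    (diag (mu *m mu^T + sigma *m sigma^T)) ->
  'E_P[fun w => (xi w i ord0 ^+ 2)%R]%E =
  (mu i ord0 ^+ 2 + sigma i ord0 ^+ 2)%:E.
Proof.
move=> /(_ i).
have -> : diag (mu *m mu^T + sigma *m sigma^T) i ord0 =
    mu i ord0 ^+ 2 + sigma i ord0 ^+ 2.
  by rewrite !mxE !big_ord1 !mxE -!expr2.
by move=> <-; congr expectation; apply/funext => w; rewrite diag_outer.
Qed.

(** Stated as an identity in the ring of functions, the form in which linearity of expectation
    applies. *)
Lemma quadform_xi :
  (fun w : vecspace R n => quadform (Amat R n) (xi w)) =
  \sum_(i < n) \sum_(j < n | (i < j)%N)
    (fun w => xi w i ord0 * xi w j ord0).
Proof.
apply/funext => w; rewrite quadform_Amat fct_sumE.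
by apply: eq_bigr => i _; rewrite fct_sumE.
Qed.

Lemma expectation_quadform_le (P : probability (vecspace R n) R) mu sigma :
  (forall i, 0 <= sigma i ord0) ->
  has_mean P (@xi R n) mu ->
  has_mean P (fun w => diag (xi w *m (xi w)^T))
    (diag (mu *m mu^T + sigma *m sigma^T)) ->
  ('E_P[fun w => quadform (Amat R n) (xi w)] <=
   (\sum_(i < n) \sum_(j < n | (i < j)%N)
      (mu i ord0 * mu j ord0 + sigma i ord0 * sigma j ord0))%:E)%E.
Proof.
move=> sigma0 Emu Ediag.
have X2 i : (fun w : vecspace R n => xi w i ord0) \in Lfun P 2%:E.
  apply: Lfun2_of_expectation; [exact: measurable_xi|exact: has_mean_diag Ediag].
(* Products of square integrable coordinates are integrable, so the expectation splits over pairs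
   and each pair is bounded on its own. *)
have XX1 i j : (fun w : vecspace R n => xi w i ord0 * xi w j ord0) \in Lfun P 1%E.
  exact: Lfun2_mul_Lfun1 (X2 i) (X2 j).
rewrite quadform_xi expectation_bigsum; last by move=> i _; apply: rpred_sum.
rewrite -sumEFin; apply: lee_sum => i _.
rewrite expectation_bigsum// -sumEFin; apply: lee_sum => j _.
by apply: expectation_mul_le => //; exact: has_mean_diag.
Qed.

Lemma supp_two_point_law (p : R) (a b : vecspace R n) :
  cube a -> cube b -> (supp (two_point_law p a b) `<=` @cube R n)%classic.
Proof.
move=> ca cb w sw i.
(* A coordinate outside [0, 1] leaves a whole ball around w free of a and b. *)
have far (e : R) : 0 < e -> (forall y, 0 <= y <= 1 -> e <= `|y - xi w i ord0|) -> False.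
  move=> e0 He; have := sw e e0.
  by rewrite two_point_law_eq0 ?ltxx// => /(_ i); rewrite ltNge He// ?ca ?cb.
(* In both cases the radius is the distance from the offending coordinate to [0, 1]. *)
apply/andP; split; rewrite leNgt; apply/negP => wi.
  apply: (far (- xi w i ord0)); first by rewrite oppr_gt0.
  by move=> y /andP[y0 y1]; rewrite ger0_norm; lra.
apply: (far (xi w i ord0 - 1)); first by rewrite subr_gt0.
by move=> y /andP[y0 y1]; rewrite ler0_norm; lra.
Qed.

End RandomVector.

(** * Attainment: the weight [p] and the comonotone law *)

Lemma max_le_min_between (R : realType) (n : nat) (hn : (0 < n)%N)
    (F G : 'I_n -> R) :
  (forall i, 0 <= F i < 1) -> (forall i, 0 < G i <= 1) ->
  max_over hn F <= min_over hn G ->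
  exists2 p, 0 < p < 1 & forall i, F i <= p <= G i.
Proof.
move=> F01 G01; rewrite /max_over /min_over.
set M := \big[_/_]_(i < n) F i; set m := \big[_/_]_(i < n) G i => Mm.
have FM i : F i <= M by exact: le_bigmax.
have mG i : m <= G i by exact: bigmin_le.
have M1 : M < 1.
  (* The iterated maximum starts from the value at the first index, so the strict bound is checked
     there too. *)
  by apply: bigmax_lt => [|i _]; [have := F01 (Ordinal hn)|have := F01 i];
    case/andP.
have m0 : 0 < m.
  by apply: lt_bigmin => [|i _]; [have := G01 (Ordinal hn)|have := G01 i];
    case/andP.
have /andP[F0 _] := F01 (Ordinal hn); have FM0 := FM (Ordinal hn).
have /andP[_ G1] := G01 (Ordinal hn); have mG0 := mG (Ordinal hn).
(* The midpoint avoids 0 and 1 even when [M] is 0 or [m] is 1, since [m] is positive and [M] is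
   below 1. *)
exists ((M + m) / 2); first by apply/andP; split; lra.
by move=> i; have := FM i; have := mG i => ? ?; apply/andP; split; lra.
Qed.

Section Attainment.
Context {R : realType} {n : nat}.
Variables (mu sigma : 'cV[R]_n) (p c : R).
Hypotheses (p01 : 0 < p < 1) (c_gt0 : 0 < c) (pc2 : p * c ^+ 2 = 1 - p).

Let vec_tuple (x : 'cV[R]_n) : vecspace R n := [tuple x i ord0 | i < n].

(* [pc2] and [c_gt0] say that [c] is [sqrt ((1 - p) / p)], which makes [mu] and
   [sigma] the means and standard deviations of this law. *)
Definition comonotone_law : probability (vecspace R n) R :=
  two_point_law p (vec_tuple (mu + c *: sigma)) (vec_tuple (mu - c^-1 *: sigma)).

Let xi_vec_tuple x : xi (vec_tuple x) = x.
Proof. by apply/colP => i; rewrite mxE tnth_mktuple. Qed.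

Lemma expectation_comonotone_law (f : vecspace R n -> R) (g : 'cV[R]_n -> R) :
  measurable_fun setT f -> f =1 g \o @xi R n ->
  'E_comonotone_law[f]%E =
    (p * g (mu + c *: sigma) + (1 - p) * g (mu - c^-1 *: sigma))%:E.
Proof.
move=> mf fg; case/andP: p01 => p0 p1.
by rewrite expectation_two_point_law ?(ltW p0) ?(ltW p1)// !fg /= !xi_vec_tuple.
Qed.

(** The coefficient of [sigma] is p c - (1 - p) / c, which vanishes by [pc2]. *)
Lemma two_point_mean i :
  p * (mu + c *: sigma) i ord0 + (1 - p) * (mu - c^-1 *: sigma) i ord0
  = mu i ord0.
Proof.
have c0 : c != 0 by rewrite gt_eqF.
by rewrite !mxE; field: pc2.
Qed.

(** The terms mixing [mu] and [sigma] cancel as for the mean; the coefficient of the product of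
    deviations is p c^2 + (1 - p) / c^2 = (1 - p) + p = 1. The case i = j gives the second
    moments. *)
Lemma two_point_product i j :
  p * ((mu + c *: sigma) i ord0 * (mu + c *: sigma) j ord0) +
  (1 - p) * ((mu - c^-1 *: sigma) i ord0 * (mu - c^-1 *: sigma) j ord0)
  = mu i ord0 * mu j ord0 + sigma i ord0 * sigma j ord0.
Proof.
have c0 : c != 0 by rewrite gt_eqF.
by rewrite !mxE; field: pc2.
Qed.

(** The last two hypotheses keep the upper atom below 1 and the lower atom above 0; the other two
    cube bounds follow from the signs of [sigma] and [c] and the range of [mu]. *)
Lemma comonotone_law_feasible :
  (forall i, 0 <= sigma i ord0) ->
  (forall i, 0 <= mu i ord0 <= 1) ->
  (forall i, sigma i ord0 * c <= 1 - mu i ord0) ->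
  (forall i, sigma i ord0 * c^-1 <= mu i ord0) ->
  feasible mu sigma comonotone_law.
Proof.
move=> sigma0 mu01 sc sc'; have cV0 : 0 < c^-1 by rewrite invr_gt0.
split.
- apply: supp_two_point_law => i; rewrite xi_vec_tuple !mxE.
    have /andP[? ?] := mu01 i; have ? := sc i.
    have ? : 0 <= c * sigma i ord0 by rewrite mulr_ge0// ltW.
    by apply/andP; split; lra.
  have /andP[? ?] := mu01 i; have ? := sc' i.
  have ? : 0 <= c^-1 * sigma i ord0 by rewrite mulr_ge0// ltW.
  by apply/andP; split; lra.
- move=> i; rewrite (@expectation_comonotone_law _ (fun x => x i ord0))//.
    by rewrite two_point_mean.
  exact: measurable_xi.
- move=> i.
  rewrite (@expectation_comonotone_law _ (fun x => x i ord0 * x i ord0)).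
  + by rewrite two_point_product !mxE !big_ord1 !mxE.
  + under eq_fun do rewrite diag_outer.
    by apply: measurable_funX; exact: measurable_xi.
  + by move=> w /=; rewrite diag_outer expr2.
Qed.

Lemma comonotone_law_value :
  'E_comonotone_law[fun w => quadform (Amat R n) (xi w)]%E =
  (\sum_(i < n) \sum_(j < n | (i < j)%N)
     (mu i ord0 * mu j ord0 + sigma i ord0 * sigma j ord0))%:E.
Proof.
rewrite (@expectation_comonotone_law _ (quadform (Amat R n)))//; last first.
  exact: measurable_quadform_xi.
congr EFin; rewrite !quadform_Amat !mulr_sumr -big_split/=.
apply: eq_bigr => i _; rewrite !mulr_sumr -big_split/=; apply: eq_bigr => j _.
exact: two_point_product.
Qed.

End Attainment.

(** * The exact maximum *)

Theorem proposition11 (R : realType) (n : nat) (hn : (1 <= n)%N)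
    (mu sigma : 'cV[R]_n)
    (hmu : forall i, 0 <= mu i ord0 <= 1)
    (hsigma : forall i, 0 <= sigma i ord0
                          <= Num.sqrt (mu i ord0 * (1 - mu i ord0)))
    (hden_max : forall i, (1 - mu i ord0) ^+ 2 + sigma i ord0 ^+ 2 != 0)
    (hden_min : forall i, mu i ord0 ^+ 2 + sigma i ord0 ^+ 2 != 0)
    (hmom : max_over hn (fun i =>
                sigma i ord0 ^+ 2 / ((1 - mu i ord0) ^+ 2 + sigma i ord0 ^+ 2))
            <= min_over hn (fun i =>
                mu i ord0 ^+ 2 / (mu i ord0 ^+ 2 + sigma i ord0 ^+ 2))) :
  is_max (values (Amat R n) mu sigma)
    (\sum_(i < n) \sum_(j < n | (i < j)%N)
       (mu i ord0 * mu j ord0 + sigma i ord0 * sigma j ord0))%:E.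
Proof.
have sigma0 i : 0 <= sigma i ord0 by case/andP: (hsigma i).
have sigma2 i : sigma i ord0 ^+ 2 <= mu i ord0 * (1 - mu i ord0).
  have /andP[m0 m1] := hmu i; have /andP[_ s_le] := hsigma i.
  have mV0 : 0 <= mu i ord0 * (1 - mu i ord0) by rewrite mulr_ge0// subr_ge0.
  by rewrite -[leRHS]sqr_sqrtr// ler_sqr ?nnegrE ?sqrtr_ge0.
split; last first.
  by move=> _ [P [_ Emu Ediag] <-]; exact: expectation_quadform_le.
have den_max i : 0 < (1 - mu i ord0) ^+ 2 + sigma i ord0 ^+ 2.
  by rewrite lt0r hden_max addr_ge0// sqr_ge0.
have den_min i : 0 < mu i ord0 ^+ 2 + sigma i ord0 ^+ 2.
  by rewrite lt0r hden_min addr_ge0// sqr_ge0.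
have [||p p01 hp] := max_le_min_between _ _ hn _ _ _ _ hmom.
(* Strictness fails only for a mean equal to 1; the bound on the deviation would then make [sigma]
   vanish, and the denominator with it. A mean equal to 0 is excluded likewise for the minimum. *)
- move=> i; rewrite divr_ge0 ?sqr_ge0 ?(ltW (den_max i))//= ltr_pdivrMr// mul1r.
  rewrite ltrDr exprn_even_gt0//=; apply/eqP => mu1.
  by have := sigma2 i; have := den_max i; rewrite mu1 mulr0 expr0n/= add0r; lra.
- move=> i; rewrite divr_gt0 ?exprn_even_gt0//= ?ler_pdivrMr ?mul1r ?lerDl ?sqr_ge0//.
  apply/eqP => mu0.
  by have := sigma2 i; have := den_min i; rewrite mu0 mul0r expr0n/= add0r; lra.
have /andP[p0 p1] := p01.
pose c := Num.sqrt ((1 - p) / p).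
have c2 : c ^+ 2 = (1 - p) / p by rewrite sqr_sqrtr// divr_ge0// ?subr_ge0 ltW.
have c_gt0 : 0 < c by rewrite sqrtr_gt0 divr_gt0// subr_gt0.
have pc2 : p * c ^+ 2 = 1 - p by rewrite c2 mulrC divfK// gt_eqF.
exists (comonotone_law mu sigma p c); last exact: comonotone_law_value.
apply: comonotone_law_feasible => // i; have /andP[m0 m1] := hmu i.
(* Squared, with c^2 = (1 - p) / p, the bound reads sigma_i^2 (1 - p) <= p (1 - mu_i)^2, which is
   the lower bound on [p]. *)
- rewrite -ler_sqr ?nnegrE ?mulr_ge0 ?subr_ge0 ?(ltW c_gt0)//.
  have /andP[+ _] := hp i; rewrite ler_pdivrMr// exprMn c2 mulrA ler_pdivrMr//.
  lra.
(* Squared, this reads sigma_i^2 p <= (1 - p) mu_i^2, which is the upper bound on [p]. *)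
- rewrite -ler_sqr ?nnegrE ?mulr_ge0 ?invr_ge0 ?(ltW c_gt0)//.
  have /andP[_] := hp i; rewrite ler_pdivlMr// exprMn exprVn c2 invf_div mulrA.
  rewrite ler_pdivrMr ?subr_gt0//; lra.
Qed.
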